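(* There exists a bounded-degree, connected, infinite graph $H$ and a vertex $v\in H$ such that $\mathrm{Comb}_v(\mathbb{Z},H)$ does not have the finite collision property; that is, two independent simple random walks on $\mathrm{Comb}_v(\mathbb{Z},H)$ collide (are at the same vertex at the same time) infinitely many times with positive probability.
   Context: For graphs $G,H$ and a vertex $v\in H$, $\mathrm{Comb}_v(G,H)$ is the graph with vertex set $V(G)\times V(H)$ and edge set $\{\{(x,w),(x,z)\}:\{w,z\}\in E(H),\,x\in V(G)\}\cup\{\{(x,v),(y,v)\}:\{x,y\}\in E(G)\}$. Here $\mathbb{Z}$ denotes the graph on the integers with edges between consecutive integers. An infinite graph has the finite collision property if for two independent simple random walks $(X_t),(Y_t)$ on it, the set $\{t: X_t=Y_t\}$ is almost surely finite. *)

(* Defs.v *)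
From Stdlib Require Import Reals List ZArith Arith Relations.
Import ListNotations.
Open Scope R_scope.

(** A locally finite graph on vertex type [V] is given by the (duplicate-free)
    list of neighbours of each vertex. *)

Definition simple_graph {V : Type} (nb : V -> list V) : Prop :=
  (forall x, NoDup (nb x)) /\
  (forall x, ~ In x (nb x)) /\
  (forall x y, In y (nb x) -> In x (nb y)).

Definition bounded_degree {V : Type} (nb : V -> list V) : Prop :=
  exists D : nat, forall x, (length (nb x) <= D)%nat.

Definition adj {V : Type} (nb : V -> list V) : relation V :=
  fun x y => In y (nb x).

Definition connected {V : Type} (nb : V -> list V) : Prop :=
  forall x y, clos_refl_trans V (adj nb) x y.

Definition Zline (x : Z) : list Z := [(x - 1)%Z; (x + 1)%Z].

Definition comb {A : Type} (nG : A -> list A) (nH : nat -> list nat) (v : nat)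
  (p : A * nat) : list (A * nat) :=
  let (x, w) := p in
  map (fun z => (x, z)) (nH w) ++
  (if Nat.eqb w v then map (fun y => (y, v)) (nG x) else []).

Fixpoint walks {V : Type} (nb : V -> list V) (a : V) (n : nat) : list (list V) :=
  match n with
  | O => [[a]]
  | S n' => flat_map (fun b => map (cons a) (walks nb b n')) (nb a)
  end.

Fixpoint walk_weight {V : Type} (nb : V -> list V) (w : list V) : R :=
  match w with
  | [] => 1
  | [_] => 1
  | x :: ((_ :: _) as t) => / INR (length (nb x)) * walk_weight nb t
  end.

Definition collide_between {V : Type} (eqd : forall x y : V, {x = y} + {x <> y})
  (N M : nat) (w1 w2 : list V) : bool :=
  existsb (fun t =>
    match nth_error w1 t, nth_error w2 t with
    | Some a, Some b => if eqd a b then true else false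
    | _, _ => false
    end) (seq N (S M - N)).

Definition collision_prob {V : Type} (nb : V -> list V)
  (eqd : forall x y : V, {x = y} + {x <> y}) (x0 y0 : V) (N M : nat) : R :=
  fold_right Rplus 0
    (flat_map (fun w1 =>
       map (fun w2 =>
         walk_weight nb w1 * walk_weight nb w2 *
         (if collide_between eqd N M w1 w2 then 1 else 0))
       (walks nb y0 M))
     (walks nb x0 M)).

(** "Collide infinitely often with positive probability":
    P(inf. many collisions) = inf_N sup_M collision_prob N M > 0. *)
Definition infinitely_many_collisions_with_pos_prob {V : Type} (nb : V -> list V)
  (eqd : forall x y : V, {x = y} + {x <> y}) (x0 y0 : V) : Prop :=
  exists eps : R, 0 < eps /\
    forall N : nat, exists M : nat, (N <= M)%nat /\
      eps <= collision_prob nb eqd x0 y0 N M.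

Definition not_finite_collision {V : Type} (nb : V -> list V)
  (eqd : forall x y : V, {x = y} + {x <> y}) : Prop :=
  exists x0 y0 : V, infinitely_many_collisions_with_pos_prob nb eqd x0 y0.

Definition Znat_eq_dec : forall x y : Z * nat, {x = y} + {x <> y}.
Proof. decide equality; [apply Nat.eq_dec | apply Z.eq_dec]. Defined.

(* Main.v *)
Require Import Defs.
From Stdlib Require Import Reals List ZArith Arith Relations Bool FinFun Lia Lra Psatz.
Import ListNotations.
Open Scope R_scope.

(** [H] is a ray 0, 1, 2, ... (the spine) carrying hairs: there are infinitely many scales
    [w] such that every spine vertex in [[w, 2w)] has a hair of length [w], spine vertices
    below [w] have hairs of length at most [w], and those in [[2w, 2w + w^2)] have none.
    Fix a scale and kill the walk on the comb when it leaves the box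
    [|x| < w, i < 2w + w^2].

    Most of the volume of the box (about [w^4]) is in the slab formed by its [~ 2w^3] hair
    vertices with [w <= i < 2w].  The gap of length [w^2] makes the resistance of a tooth to
    its far end so large that the walk started at the origin spends a time of order [w^4] in
    the slab before dying, while its mean lifetime is also of order [w^4]; by Cauchy-Schwarz
    the expected number of collisions of two such walks in the slab is at least of order
    [w^4 * w^4 / (w^4 * w^3) = w].  On the other hand every vertex of the slab is at distance
    at most [4w] from the ends of the base, so after a collision there the expected number
    of further collisions is at most of order [w].  Hence the two walks collide in the slab
    with probability bounded below uniformly in the scale.  The occupation times are
    controlled by explicit super- and subharmonic functions. *)

#[local] Arguments Nat.ltb : simpl never.

(** * Finite real sums over lists *)

Definition rsum {A : Type} (l : list A) (f : A -> R) : R :=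
  fold_right Rplus 0 (map f l).

Section Rsum.
Context {A : Type}.
Implicit Types (l : list A) (f g : A -> R).

Lemma rsum_cons a l f : rsum (a :: l) f = f a + rsum l f.
Proof. reflexivity. Qed.

Lemma rsum_app l1 l2 f : rsum (l1 ++ l2) f = rsum l1 f + rsum l2 f.
Proof.
  induction l1 as [|a l1 IH]; simpl; rewrite ?rsum_cons.
  - unfold rsum; simpl; ring.
  - rewrite IH; ring.
Qed.

Lemma rsum_ext l f g : (forall a, In a l -> f a = g a) -> rsum l f = rsum l g.
Proof. intros H. unfold rsum. f_equal. now apply map_ext_in. Qed.

Lemma rsum_le l f g : (forall a, In a l -> f a <= g a) -> rsum l f <= rsum l g.
Proof.
  induction l as [|a l IH]; intros H.
  - apply Rle_refl.
  - rewrite !rsum_cons. apply Rplus_le_compat; [apply H; now left|].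
    apply IH. intros b Hb. apply H. now right.
Qed.

Lemma rsum_const l c : rsum l (fun _ => c) = INR (length l) * c.
Proof.
  induction l as [|a l IH].
  - unfold rsum; simpl; ring.
  - rewrite rsum_cons, IH. cbn [length]. rewrite S_INR. ring.
Qed.

Lemma rsum_nonneg l f : (forall a, In a l -> 0 <= f a) -> 0 <= rsum l f.
Proof.
  intros H. apply Rle_trans with (rsum l (fun _ => 0)).
  - rewrite rsum_const; lra.
  - now apply rsum_le.
Qed.

Lemma rsum_plus l f g : rsum l (fun a => f a + g a) = rsum l f + rsum l g.
Proof.
  induction l as [|a l IH].
  - unfold rsum; simpl; ring.
  - rewrite !rsum_cons, IH. ring.
Qed.

Lemma rsum_scal l f c : rsum l (fun a => c * f a) = c * rsum l f.
Proof.
  induction l as [|a l IH].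
  - unfold rsum; simpl; ring.
  - rewrite !rsum_cons, IH. ring.
Qed.

Lemma rsum_single (eqd : forall x y : A, {x = y} + {x <> y}) l a f :
  NoDup l ->
  rsum l (fun b => (if eqd a b then 1 else 0) * f b) =
  if in_dec eqd a l then f a else 0.
Proof.
  induction l as [|b l IH]; intros Hnd; [reflexivity|].
  inversion Hnd as [|? ? Hb Hl]; subst.
  rewrite rsum_cons, (IH Hl).
  destruct (eqd a b) as [->|Hne].
  - destruct (in_dec eqd b l) as [Hi|_]; [contradiction|].
    destruct (in_dec eqd b (b :: l)) as [_|Hn]; [ring|].
    elim Hn; now left.
  - destruct (in_dec eqd a l) as [Hi|Hi];
      destruct (in_dec eqd a (b :: l)) as [Hj|Hj]; try ring.
    + elim Hj; now right.
    + destruct Hj as [->|Hj]; [now elim Hne|contradiction].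
Qed.

End Rsum.

Lemma rsum_map {A B : Type} (h : B -> A) (l : list B) (f : A -> R) :
  rsum (map h l) f = rsum l (fun b => f (h b)).
Proof. unfold rsum. now rewrite map_map. Qed.

Lemma rsum_flat_map {A B : Type} (h : B -> list A) (l : list B) (f : A -> R) :
  rsum (flat_map h l) f = rsum l (fun b => rsum (h b) f).
Proof.
  induction l as [|b l IH]; [reflexivity|].
  cbn [flat_map]. now rewrite rsum_app, IH, rsum_cons.
Qed.

Lemma rsum_swap {A B : Type} (l : list A) (l' : list B) (f : A -> B -> R) :
  rsum l (fun a => rsum l' (f a)) = rsum l' (fun b => rsum l (fun a => f a b)).
Proof.
  induction l as [|a l IH].
  - symmetry. unfold rsum at 2; simpl. rewrite rsum_const. unfold rsum; simpl; ring.
  - rewrite rsum_cons, IH, <- rsum_plus. apply rsum_ext. intros b _. now rewrite rsum_cons.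
Qed.

(** * Path expectations and collision probabilities for simple random walk *)

Section KilledWalk.
Context {V : Type} (nb : V -> list V) (eqd : forall x y : V, {x = y} + {x <> y}).
Hypothesis nb_nonempty : forall a, nb a <> [].
Implicit Types (f g : V -> R) (a b z : V).

Definition deg a : R := INR (length (nb a)).

Lemma deg_ge1 a : 1 <= deg a.
Proof.
  unfold deg. specialize (nb_nonempty a). destruct (nb a) as [|b l]; [easy|].
  cbn [length]. rewrite S_INR. pose proof (pos_INR (length l)). lra.
Qed.

Definition avg f a : R := / deg a * rsum (nb a) f.

Lemma avg_le f g a : (forall b, In b (nb a) -> f b <= g b) -> avg f a <= avg g a.
Proof.
  intros H. unfold avg. apply Rmult_le_compat_l; [|now apply rsum_le].
  pose proof (deg_ge1 a). apply Rlt_le, Rinv_0_lt_compat. lra.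
Qed.

Lemma avg_ext f g a : (forall b, In b (nb a) -> f b = g b) -> avg f a = avg g a.
Proof. intros H. unfold avg. f_equal. now apply rsum_ext. Qed.

Lemma avg_const c a : avg (fun _ => c) a = c.
Proof. unfold avg. rewrite rsum_const. pose proof (deg_ge1 a). unfold deg in *. field. lra. Qed.

Lemma avg_plus f g a : avg (fun b => f b + g b) a = avg f a + avg g a.
Proof. unfold avg. rewrite rsum_plus. ring. Qed.

Lemma avg_scal c f a : avg (fun b => c * f b) a = c * avg f a.
Proof. unfold avg. rewrite rsum_scal. ring. Qed.

Lemma avg_rsum {I : Type} (l : list I) (F : I -> V -> R) a :
  avg (fun b => rsum l (fun i => F i b)) a = rsum l (fun i => avg (F i) a).
Proof. unfold avg. rewrite rsum_swap, <- rsum_scal. reflexivity. Qed.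

(** The degree-weighted Laplacian, with the sign that makes it nonnegative on superharmonic
    functions. Being a plain sum over edges, it can be computed without knowing the degree. *)
Definition lap f a : R := rsum (nb a) (fun b => f a - f b).

Lemma lap_avg f a : lap f a = deg a * (f a - avg f a).
Proof.
  unfold lap. rewrite (rsum_ext _ _ (fun b => f a + (-1) * f b)) by (intros; ring).
  rewrite rsum_plus, rsum_const, rsum_scal. unfold avg.
  pose proof (deg_ge1 a). unfold deg in *. field. lra.
Qed.

Definition expect (n : nat) a (F : list V -> R) : R :=
  rsum (walks nb a n) (fun w => walk_weight nb w * F w).

Lemma walks_head n a w : In w (walks nb a n) -> exists t, w = a :: t.
Proof.
  destruct n as [|n]; simpl.
  - intros [<-|[]]. now exists [].
  - rewrite in_flat_map. intros (b & _ & Hw). apply in_map_iff in Hw.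
    destruct Hw as (t & <- & _). now exists t.
Qed.

Lemma expect_S n a F :
  expect (S n) a F = avg (fun b => expect n b (fun w => F (a :: w))) a.
Proof.
  unfold expect at 1. cbn [walks]. rewrite rsum_flat_map. unfold avg.
  rewrite <- rsum_scal. apply rsum_ext. intros b Hb. rewrite rsum_map.
  unfold expect. rewrite <- rsum_scal. apply rsum_ext. intros w Hw.
  destruct (walks_head _ _ _ Hw) as [t ->].
  change (walk_weight nb (a :: b :: t)) with (/ deg a * walk_weight nb (b :: t)). ring.
Qed.

Lemma expect_ext n a F G :
  (forall w, In w (walks nb a n) -> F w = G w) -> expect n a F = expect n a G.
Proof. intros H. apply rsum_ext. intros w Hw. now rewrite (H w Hw). Qed.

Lemma expect_const n a c : expect n a (fun _ => c) = c.
Proof.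
  revert a. induction n as [|n IH]; intros a.
  - unfold expect, rsum; simpl; ring.
  - rewrite expect_S. rewrite (avg_ext _ (fun _ => c)) by (intros; apply IH).
    apply avg_const.
Qed.

Lemma expect_le n a F G :
  (forall w, In w (walks nb a n) -> F w <= G w) -> expect n a F <= expect n a G.
Proof.
  revert a F G. induction n as [|n IH]; intros a F G H.
  - unfold expect, rsum; simpl. specialize (H [a] (or_introl eq_refl)). lra.
  - rewrite !expect_S. apply avg_le. intros b Hb. apply IH. intros w Hw. apply H.
    cbn [walks]. apply in_flat_map. exists b. split; [easy|]. now apply in_map.
Qed.

Definition hit (N M : nat) (w1 w2 : list V) : R :=
  if collide_between eqd N M w1 w2 then 1 else 0.

Lemma collision_prob_expect a b N M :
  collision_prob nb eqd a b N M =
  expect M a (fun w1 => expect M b (fun w2 => hit N M w1 w2)).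
Proof.
  unfold collision_prob, expect.
  transitivity (rsum (flat_map (fun w1 => map (fun w2 =>
     walk_weight nb w1 * walk_weight nb w2 * hit N M w1 w2) (walks nb b M))
     (walks nb a M)) (fun x => x)).
  - unfold rsum. now rewrite map_id.
  - rewrite rsum_flat_map. apply rsum_ext. intros w1 _. rewrite rsum_map, <- rsum_scal.
    apply rsum_ext. intros; ring.
Qed.

Lemma collision_prob_nonneg a b N M : 0 <= collision_prob nb eqd a b N M.
Proof.
  rewrite collision_prob_expect, <- (expect_const M a 0).
  apply expect_le. intros w1 _. rewrite <- (expect_const M b 0).
  apply expect_le. intros w2 _. unfold hit. destruct collide_between; lra.
Qed.

Lemma collision_prob_same a M : collision_prob nb eqd a a 0 M = 1.
Proof.
  rewrite collision_prob_expect, <- (expect_const M a 1).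
  apply expect_ext. intros w1 H1. transitivity (expect M a (fun _ => 1)); [|now rewrite expect_const].
  apply expect_ext. intros w2 H2.
  destruct (walks_head _ _ _ H1) as [t1 ->]. destruct (walks_head _ _ _ H2) as [t2 ->].
  unfold hit, collide_between. cbn. destruct (eqd a a); [reflexivity|easy].
Qed.

Lemma existsb_map {A B : Type} (h : A -> B) (P : B -> bool) l :
  existsb P (map h l) = existsb (fun x => P (h x)) l.
Proof. induction l as [|x l IH]; simpl; [easy|now rewrite IH]. Qed.

(** Both walks take their first step at once: the new starting points are averaged independently and
    the time window moves back by one. *)
Lemma collision_prob_shift a b N M :
  collision_prob nb eqd a b (S N) (S M) =
  avg (fun a' => avg (fun b' => collision_prob nb eqd a' b' N M) b) a.
Proof.
  rewrite collision_prob_expect, expect_S. apply avg_ext. intros a' _.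
  transitivity (expect M a' (fun w => avg (fun b' => expect M b' (hit N M w)) b)).
  - apply expect_ext. intros w1 _. rewrite expect_S. apply avg_ext. intros b' _.
    apply expect_ext. intros w2 _. unfold hit, collide_between.
    replace (S (S M) - S N)%nat with (S M - N)%nat by lia.
    now rewrite <- seq_shift, existsb_map.
  - unfold expect at 1.
    rewrite (rsum_ext _ _ (fun w => avg (fun b' => walk_weight nb w * expect M b' (hit N M w)) b))
      by (intros; now rewrite avg_scal).
    rewrite <- avg_rsum. apply avg_ext. intros b' _. now rewrite collision_prob_expect.
Qed.

Lemma collision_prob_antimono a b N M :
  collision_prob nb eqd a b (S N) M <= collision_prob nb eqd a b N M.
Proof.
  rewrite !collision_prob_expect. apply expect_le. intros w1 _. apply expect_le. intros w2 _.
  unfold hit. destruct (collide_between eqd (S N) M w1 w2) eqn:E1;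
    destruct (collide_between eqd N M w1 w2) eqn:E2; try lra.
  unfold collide_between in E1, E2. apply existsb_exists in E1. destruct E1 as (t & Ht & E1).
  rewrite <- not_true_iff_false in E2. elim E2. apply existsb_exists. exists t.
  split; [|exact E1]. apply in_seq in Ht. apply in_seq. lia.
Qed.

(** * The walk killed outside [B]: kernels, occupation times and comparison principles *)

Variable B : V -> bool.

Definition kill f a : R := if B a then avg f a else 0.
(** The expectation of [f] at time [n] on the event that the walk is in [B] at times
    [0, ..., n - 1]; the position at time [n] itself may lie outside [B]. *)
Definition killn (n : nat) f : V -> R := Nat.iter n kill f.
Definition delta z a : R := if eqd a z then 1 else 0.
Definition occ (l : list nat) g a : R := rsum l (fun t => killn t g a).

Lemma killn_S n f a : killn (S n) f a = kill (killn n f) a.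
Proof. reflexivity. Qed.

Lemma kill_le f g a : (forall b, f b <= g b) -> kill f a <= kill g a.
Proof. intros H. unfold kill. destruct (B a); [|lra]. apply avg_le. auto. Qed.

Lemma killn_le n f g a : (forall b, f b <= g b) -> killn n f a <= killn n g a.
Proof.
  intros H. revert a. induction n as [|n IH]; intros a; [apply H|].
  rewrite !killn_S. now apply kill_le.
Qed.

Lemma killn_ext n f g a : (forall b, f b = g b) -> killn n f a = killn n g a.
Proof. intros H. apply Rle_antisym; apply killn_le; intros b; rewrite H; apply Rle_refl. Qed.

Lemma kill_rsum {I : Type} (l : list I) (c : I -> R) (F : I -> V -> R) a :
  kill (fun b => rsum l (fun i => c i * F i b)) a = rsum l (fun i => c i * kill (F i) a).
Proof.
  unfold kill. destruct (B a).
  - rewrite avg_rsum. apply rsum_ext. intros; apply avg_scal.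
  - rewrite (rsum_ext _ _ (fun _ => 0)) by (intros; ring). rewrite rsum_const. ring.
Qed.

Lemma kill_ext f g a : (forall b, f b = g b) -> kill f a = kill g a.
Proof. intros H. unfold kill. destruct (B a); [apply avg_ext|]; auto. Qed.

Lemma killn_rsum {I : Type} n (l : list I) (c : I -> R) (F : I -> V -> R) a :
  killn n (fun b => rsum l (fun i => c i * F i b)) a = rsum l (fun i => c i * killn n (F i) a).
Proof.
  revert a. induction n as [|n IH]; intros a; [reflexivity|].
  rewrite killn_S, (kill_ext _ _ _ IH). apply kill_rsum.
Qed.

Lemma killn_nonneg n f a : (forall b, 0 <= f b) -> 0 <= killn n f a.
Proof.
  intros H. revert a. induction n as [|n IH]; intros a; [apply H|].
  rewrite killn_S. unfold kill. destruct (B a); [|lra].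
  rewrite <- (avg_const 0 a). now apply avg_le.
Qed.

Lemma killn_le1 n f a : (forall b, f b <= 1) -> killn n f a <= 1.
Proof.
  intros H. revert a. induction n as [|n IH]; intros a; [apply H|].
  rewrite killn_S. unfold kill. destruct (B a); [|lra].
  rewrite <- (avg_const 1 a). now apply avg_le.
Qed.

Lemma killn_add n m f a : killn (n + m) f a = killn n (killn m f) a.
Proof. unfold killn. now rewrite Nat.iter_add. Qed.

Lemma delta_nonneg z b : 0 <= delta z b.
Proof. unfold delta. destruct eqd; lra. Qed.

Lemma occ_S n g a : occ (seq 0 (S n)) g a = g a + kill (occ (seq 0 n) g) a.
Proof.
  unfold occ. cbn [seq]. rewrite rsum_cons. f_equal.
  rewrite <- seq_shift, rsum_map.
  rewrite (kill_ext _ (fun b => rsum (seq 0 n) (fun t => 1 * killn t g b))).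
  - rewrite kill_rsum. apply rsum_ext. intros t _. exact (eq_sym (Rmult_1_l _)).
  - intros b. apply rsum_ext. intros; ring.
Qed.

(** Maximum principle, by induction on the horizon: each step collects [g] and leaves at least the
    average of [h] to pay for the rest. Here [cl] stands for [B] with its outer boundary, the only
    place where [h] has to be controlled. *)
Lemma occ_supersolution (cl : V -> Prop) g h n a :
  (forall a b, B a = true -> In b (nb a) -> cl b) ->
  (forall a, cl a -> 0 <= h a) ->
  (forall a, B a = false -> g a = 0) ->
  (forall a, cl a -> B a = true -> g a + avg h a <= h a) ->
  cl a -> occ (seq 0 n) g a <= h a.
Proof.
  intros Hcl Hpos Hout Hin. revert a. induction n as [|n IH]; intros a Ha.
  - apply Hpos, Ha.
  - rewrite occ_S. unfold kill. destruct (B a) eqn:Ba.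
    + apply Rle_trans with (g a + avg h a); [|auto].
      apply Rplus_le_compat_l, avg_le. intros b Hb. apply IH. eauto.
    + rewrite (Hout a Ba). specialize (Hpos a Ha). lra.
Qed.

Definition inB a : R := if B a then 1 else 0.

(** The reverse comparison at a finite horizon: a walk still alive at time [n] has an uncollected
    value of at most [U], which gives the survival term. The bound by [U * inB] also makes [u]
    nonpositive on the killing boundary. *)
Lemma occ_subsolution (cl : V -> Prop) g u U n a :
  (forall a b, B a = true -> In b (nb a) -> cl b) ->
  (forall a, 0 <= g a) ->
  0 <= U ->
  (forall a, cl a -> u a <= U * inB a) ->
  (forall a, cl a -> B a = true -> u a <= g a + avg u a) ->
  cl a -> u a <= occ (seq 0 n) g a + U * killn n inB a.
Proof.
  intros Hcl Hg HU Hbd Hin. revert a. induction n as [|n IH]; intros a Ha.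
  - specialize (Hbd a Ha). unfold occ, rsum; simpl. lra.
  - rewrite occ_S, killn_S. unfold kill at 1 2. destruct (B a) eqn:Ba.
    + apply Rle_trans with (1 := Hin a Ha Ba). rewrite Rplus_assoc.
      apply Rplus_le_compat_l. rewrite <- avg_scal, <- avg_plus.
      apply avg_le. intros b Hb. apply IH. eauto.
    + specialize (Hbd a Ha). unfold inB in Hbd. rewrite Ba in Hbd. specialize (Hg a). lra.
Qed.

Lemma killn_inB_decr n a : killn (S n) inB a <= killn n inB a.
Proof.
  revert a. induction n as [|n IH]; intros a.
  - rewrite killn_S. unfold kill. cbn. unfold inB at 2. destruct (B a); [|lra].
    rewrite <- (avg_const 1 a). apply avg_le. intros b _. unfold inB. destruct (B b); lra.
  - rewrite (killn_S (S n)), (killn_S n). now apply kill_le.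
Qed.

(** Survival probabilities decrease in time, so [n] times the last one is at most their sum, a
    truncated mean lifetime. *)
Lemma survival_le n a : INR n * killn n inB a <= occ (seq 0 n) inB a.
Proof.
  induction n as [|n IH].
  - unfold occ, rsum; simpl. lra.
  - rewrite S_INR. unfold occ in *. rewrite seq_S, rsum_app, rsum_cons.
    unfold rsum at 2. cbn [map fold_right Nat.add].
    pose proof (killn_inB_decr n a). pose proof (pos_INR n). nra.
Qed.

(** * Reversibility of the killed walk *)

Hypothesis nb_nodup : forall a, NoDup (nb a).
Hypothesis nb_sym : forall a b, In b (nb a) -> In a (nb b).

Lemma deg_pos a : 0 < deg a.
Proof. pose proof (deg_ge1 a). lra. Qed.

(** The one-step kernel read from its target: [z] is entered only from its neighbours inside [B].
    Iterated, this decomposes a path by its last step. *)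
Lemma kill_delta z a :
  kill (delta z) a = rsum (nb z) (fun b => inB b * / deg b * delta b a).
Proof.
  transitivity (rsum (nb z) (fun b => (if eqd a b then 1 else 0) * (inB b * / deg b))).
  2:{ apply rsum_ext. intros b _. unfold delta. ring. }
  rewrite rsum_single by auto.
  unfold kill, avg, inB, delta.
  rewrite (rsum_ext (nb a) _ (fun b => (if eqd z b then 1 else 0) * 1))
    by (intros b _; destruct (eqd b z), (eqd z b); subst; try ring; easy).
  rewrite rsum_single by auto.
  destruct (B a), (in_dec eqd z (nb a)) as [i|n], (in_dec eqd a (nb z)) as [i'|n']; try ring;
    try (elim n; now apply nb_sym); try (elim n'; now apply nb_sym).
Qed.

Lemma killn_delta_forward n z a :
  killn (S n) (delta z) a = rsum (nb z) (fun b => inB b * / deg b * killn n (delta b) a).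
Proof.
  unfold killn at 1. rewrite Nat.iter_succ_r. fold (killn n (kill (delta z))).
  rewrite (killn_ext _ _ _ _ (kill_delta z)). apply killn_rsum.
Qed.

(** Detailed balance for the degree measure: the induction opens one side at its first step and the
    other at its last step. Both endpoints must lie in [B], because the kernel does not test its
    final position. *)
Lemma killn_reversible n a z : B a = true -> B z = true ->
  deg a * killn n (delta z) a = deg z * killn n (delta a) z.
Proof.
  revert a z. induction n as [|n IH]; intros a z Ba Bz.
  - cbn. unfold delta. destruct (eqd a z), (eqd z a); subst; try ring; easy.
  - rewrite (killn_delta_forward n a z), killn_S. unfold kill. rewrite Ba. unfold avg.
    pose proof (deg_pos a). rewrite <- Rmult_assoc, Rinv_r, Rmult_1_l by lra.
    rewrite <- rsum_scal. apply rsum_ext. intros b _. unfold inB.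
    pose proof (deg_pos b). destruct (B b) eqn:Bb.
    + specialize (IH b z Bb Bz).
      apply Rmult_eq_reg_l with (deg b); [|lra]. rewrite IH. field. lra.
    + replace (killn n (delta z) b) with 0; [ring|]. destruct n as [|n].
      * cbn. unfold delta. destruct (eqd b z); [congruence|easy].
      * rewrite killn_S. unfold kill. now rewrite Bb.
Qed.

(** * Collisions of two killed walks inside a finite set *)

Variable S0 : list V.
Hypothesis S0_nodup : NoDup S0.
Hypothesis S0_B : forall z, In z S0 -> B z = true.

Definition indic a : R := rsum S0 (fun z => delta z a).

Lemma indic_eq a : indic a = if in_dec eqd a S0 then 1 else 0.
Proof.
  unfold indic, delta. rewrite (rsum_ext _ _ (fun b => (if eqd a b then 1 else 0) * 1)) by (intros; ring).
  exact (rsum_single eqd S0 a (fun _ => 1) S0_nodup).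
Qed.

(** The probability that two independent killed walks from [a] and [b] are at a common vertex of
    [S0] at time [t]. *)
Definition pairk (t : nat) a b : R :=
  rsum S0 (fun z => killn t (delta z) a * killn t (delta z) b).

(** Only an inequality, since paths whose position at time [s] is outside [S0] are dropped. *)
Lemma chapman_kolmogorov_le s t a z :
  rsum S0 (fun y => killn s (delta y) a * killn t (delta z) y) <= killn (s + t) (delta z) a.
Proof.
  rewrite killn_add.
  rewrite (rsum_ext _ _ (fun y => killn t (delta z) y * killn s (delta y) a)) by (intros; ring).
  rewrite <- killn_rsum. apply killn_le. intros b. unfold delta at 2.
  rewrite (rsum_ext _ _ (fun y => (if eqd b y then 1 else 0) * killn t (delta z) y)) by (intros; ring).
  rewrite rsum_single by auto.
  destruct in_dec; [lra|]. apply killn_nonneg, delta_nonneg.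
Qed.

(** Reversing one of the two walks, at the cost of a degree ratio of at most [D], glues them into a
    single return path of length [t + t]. *)
Lemma pairk_diag D t z : (forall a, deg a <= D) -> B z = true ->
  pairk t z z <= D * killn (t + t) (delta z) z.
Proof.
  intros HD Bz. assert (D1 : 1 <= D) by (specialize (HD z); pose proof (deg_ge1 z); lra).
  eapply Rle_trans; [|apply Rmult_le_compat_l; [lra|apply chapman_kolmogorov_le]].
  rewrite <- rsum_scal. apply rsum_le. intros y Hy.
  pose proof (killn_reversible t z y Bz (S0_B y Hy)) as E.
  pose proof (killn_nonneg t _ z (delta_nonneg y)) as P1.
  pose proof (killn_nonneg t _ y (delta_nonneg z)) as P2.
  specialize (HD y). pose proof (deg_ge1 z) as Dz.
  assert (killn t (delta y) z <= D * killn t (delta z) y) by nra.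
  nra.
Qed.

Lemma pairk_S t a b :
  pairk (S t) a b = inB a * inB b * avg (fun a' => avg (fun b' => pairk t a' b') b) a.
Proof.
  unfold pairk at 1, inB.
  rewrite (avg_ext _ (fun a' => rsum S0 (fun z => avg (killn t (delta z)) b * killn t (delta z) a'))).
  - rewrite avg_rsum. rewrite <- rsum_scal. apply rsum_ext. intros z _.
    rewrite avg_scal, !killn_S. unfold kill. destruct (B a), (B b); ring.
  - intros a' _. unfold pairk. rewrite avg_rsum. apply rsum_ext. intros z _.
    rewrite avg_scal. ring.
Qed.

(* Markov property at the first collision, carried out as an induction on [M]. *)
Lemma collision_prob_lower G a b N M :
  0 < G ->
  (forall z n, In z S0 -> rsum (seq 0 n) (fun t => pairk t z z) <= G) ->
  rsum (seq N (S M - N)) (fun t => pairk t a b) <= G * collision_prob nb eqd a b N M.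
Proof.
  intros HG Hdiag.
  (* One simultaneous step passes from windows starting at [N] to windows starting at [S N]; the
     killing factors are at most 1 and are dropped on the left. *)
  assert (Hstep : forall M N, (forall a b, rsum (seq N (S M - N)) (fun t => pairk t a b)
      <= G * collision_prob nb eqd a b N M) -> forall a b,
    rsum (seq (S N) (S (S M) - S N)) (fun t => pairk t a b)
      <= G * collision_prob nb eqd a b (S N) (S M)).
  { clear a b N M. intros M N IH a b.
    replace (S (S M) - S N)%nat with (S M - N)%nat by lia.
    rewrite <- seq_shift, rsum_map, collision_prob_shift, <- avg_scal.
    rewrite (rsum_ext _ _ _ (fun t _ => pairk_S t a b)), rsum_scal, <- avg_rsum.
    eapply Rle_trans.
    2:{ apply avg_le. intros a' _.
        apply Req_le, (avg_scal G (fun b' => collision_prob nb eqd a' b' N M) b). }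
    eapply Rle_trans.
    2:{ apply avg_le. intros a' _. apply avg_le. intros b' _. apply IH. }
    match goal with |- _ * ?X <= ?Y => replace X with Y end.
    - match goal with |- _ * ?X <= _ => assert (0 <= X) end.
      { rewrite <- (avg_const 0 a). apply avg_le. intros a' _.
        rewrite <- (avg_const 0 b). apply avg_le. intros b' _.
        apply rsum_nonneg. intros t _. apply rsum_nonneg. intros z _.
        apply Rmult_le_pos; apply killn_nonneg, delta_nonneg. }
      unfold inB. destruct (B a), (B b); nra.
    - apply avg_ext. intros a' _. now rewrite avg_rsum. }
  revert N a b. induction M as [|M IH]; intros N a b.
  - destruct N as [|N].
    + destruct (eqd a b) as [->|Hne]; [destruct (in_dec eqd b S0) as [Hi|Hn]|].
      * rewrite collision_prob_same, Rmult_1_r. now apply Hdiag.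
      * pose proof (collision_prob_nonneg b b 0 0).
        cbn [Nat.sub seq]. unfold rsum; cbn [map fold_right].
        replace (pairk 0 b b) with 0; [nra|].
        unfold pairk; cbn. symmetry.
        rewrite (rsum_ext _ _ (fun _ => 0)); [rewrite rsum_const; ring|].
        intros z Hz. unfold delta. destruct (eqd b z); [now subst|ring].
      * pose proof (collision_prob_nonneg a b 0 0).
        cbn [Nat.sub seq]. unfold rsum; cbn [map fold_right].
        replace (pairk 0 a b) with 0; [nra|].
        unfold pairk; cbn. symmetry.
        rewrite (rsum_ext _ _ (fun _ => 0)); [rewrite rsum_const; ring|].
        intros z Hz. unfold delta. destruct (eqd a z), (eqd b z); subst; try ring; easy.
    + replace (1 - S N)%nat with 0%nat by lia.
      pose proof (collision_prob_nonneg a b (S N) 0). unfold rsum; cbn. nra.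
  - destruct N as [|N]; [|now apply Hstep].
    (* If time 0 contributes nothing to the sum, the window may start at time 1, where [Hstep]
       applies. *)
    assert (Hz : pairk 0 a b = 0 -> rsum (seq 0 (S (S M) - 0)) (fun t => pairk t a b) <=
       G * collision_prob nb eqd a b 0 (S M)).
    { intros E. specialize (Hstep M 0%nat (IH 0%nat) a b).
      pose proof (collision_prob_antimono a b 0 (S M)).
      replace (S (S M) - 0)%nat with (S (S M)) by lia. cbn [seq]. rewrite rsum_cons, E.
      replace (S (S M) - 1)%nat with (S M) in Hstep by lia.
      assert (G * collision_prob nb eqd a b 1 (S M) <= G * collision_prob nb eqd a b 0 (S M)).
      { apply Rmult_le_compat_l; lra. }
      cbn [seq] in *. lra. }
    destruct (eqd a b) as [->|Hne]; [destruct (in_dec eqd b S0) as [Hi|Hn]|].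
    (* The walks start together in [S0]: the collision probability is 1, and [G] bounds the whole
       sum. *)
    + rewrite collision_prob_same, Rmult_1_r. now apply Hdiag.
    + apply Hz. unfold pairk; cbn.
      rewrite (rsum_ext _ _ (fun _ => 0)); [rewrite rsum_const; ring|].
      intros z Hz'. unfold delta. destruct (eqd b z); [now subst|ring].
    + apply Hz. unfold pairk; cbn.
      rewrite (rsum_ext _ _ (fun _ => 0)); [rewrite rsum_const; ring|].
      intros z Hz'. unfold delta. destruct (eqd a z), (eqd b z); subst; try ring; easy.
Qed.

Lemma rsum_even_le n (F : nat -> R) : (forall t, 0 <= F t) ->
  rsum (seq 0 n) (fun t => F (t + t)%nat) <= rsum (seq 0 (n + n)) F.
Proof.
  intros HF. induction n as [|n IH]; [unfold rsum; simpl; lra|].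
  replace (S n + S n)%nat with (S (S (n + n))) by lia.
  rewrite !seq_S, !rsum_app. unfold rsum at 2 4 5. cbn [map fold_right Nat.add].
  pose proof (HF (S (n + n))). lra.
Qed.

(** Returns at even times are part of the Green function of the killed walk at [z], which the
    supersolution [h] dominates. *)
Lemma pairk_sum_diag D n z h (cl : V -> Prop) :
  (forall a, deg a <= D) -> B z = true -> cl z ->
  (forall a b, B a = true -> In b (nb a) -> cl b) ->
  (forall a, cl a -> 0 <= h a) ->
  (forall a, cl a -> B a = true -> delta z a + avg h a <= h a) ->
  rsum (seq 0 n) (fun t => pairk t z z) <= D * h z.
Proof.
  intros HD Bz Cz Hcl Hpos Hin.
  assert (D1 : 1 <= D) by (specialize (HD z); pose proof (deg_ge1 z); lra).
  apply Rle_trans with (D * rsum (seq 0 n) (fun t => killn (t + t) (delta z) z)).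
  - rewrite <- rsum_scal. apply rsum_le. intros t _. now apply pairk_diag.
  - apply Rmult_le_compat_l; [lra|].
    apply Rle_trans with (occ (seq 0 (n + n)) (delta z) z).
    + apply (rsum_even_le n (fun t => killn t (delta z) z)).
      intros t. apply killn_nonneg, delta_nonneg.
    + apply occ_supersolution with cl; auto.
      intros a Ba. unfold delta. destruct (eqd a z); [congruence|easy].
Qed.

Lemma killn_indic t a : killn t indic a = rsum S0 (fun z => killn t (delta z) a).
Proof.
  rewrite (killn_ext t indic (fun b => rsum S0 (fun z => 1 * delta z b))).
  - rewrite killn_rsum. apply rsum_ext. intros; ring.
  - intros b. apply rsum_ext. intros; ring.
Qed.

(* Cauchy-Schwarz in the linearised form [p^2 >= 2 lam p - lam^2]. *)
Lemma pairk_sum_lower lam a N M :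
  2 * lam * occ (seq N (S M - N)) indic a - lam ^ 2 * INR (S M) * INR (length S0)
  <= rsum (seq N (S M - N)) (fun t => pairk t a a).
Proof.
  apply Rle_trans with (rsum (seq N (S M - N))
    (fun t => 2 * lam * killn t indic a + - (lam ^ 2 * INR (length S0)))).
  - rewrite rsum_plus, rsum_scal, rsum_const, length_seq. unfold occ.
    assert (INR (S M - N) <= INR (S M)) by (apply le_INR; lia).
    assert (0 <= lam ^ 2 * INR (length S0))
      by (apply Rmult_le_pos; [apply pow2_ge_0|apply pos_INR]).
    nra.
  - apply rsum_le. intros t _. rewrite killn_indic. unfold pairk.
    apply Rle_trans with (rsum S0 (fun z => 2 * lam * killn t (delta z) a + - lam ^ 2)).
    + rewrite rsum_plus, rsum_scal, rsum_const. lra.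
    + apply rsum_le. intros z _. pose proof (pow2_ge_0 (killn t (delta z) a - lam)). nra.
Qed.

(** Combines the first and second moment bounds. The function [f] bounds the lifetime from above,
    [u] the occupation of [S0] from below, and [h z] the Green function with pole [z]; [lam] is the
    free parameter of Cauchy-Schwarz. *)
Lemma collision_prob_criterion (cl : V -> Prop) (f u : V -> R) (h : V -> V -> R)
  (D G U lam : R) (N M : nat) o :
  (forall a, deg a <= D) ->
  (forall a, B a = true -> cl a) ->
  (forall a b, B a = true -> In b (nb a) -> cl b) ->
  (forall a, cl a -> 0 <= f a) ->
  (forall a, B a = true -> 1 + avg f a <= f a) ->
  0 <= U ->
  (forall a, cl a -> u a <= U * inB a) ->
  (forall a, B a = true -> u a <= indic a + avg u a) ->
  (forall z a, In z S0 -> cl a -> 0 <= h z a) ->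
  (forall z a, In z S0 -> B a = true -> delta z a + avg (h z) a <= h z a) ->
  (forall z, In z S0 -> h z z <= G) -> 0 < G -> 0 <= lam -> (N <= M)%nat -> cl o ->
  2 * lam * (u o - U * f o / INR (S M) - INR N) - lam ^ 2 * INR (S M) * INR (length S0)
  <= D * G * collision_prob nb eqd o o N M.
Proof.
  intros HD HBcl Hcl Hf0 Hf HU Hu0 Hu Hh0 Hh HG G0 Hlam HNM Ho.
  assert (D1 : 1 <= D) by (specialize (HD o); pose proof (deg_ge1 o); lra).
  eapply Rle_trans; [|apply collision_prob_lower; [nra|]].
  2:{ intros z n Hz. apply Rle_trans with (D * h z z).
      - apply pairk_sum_diag with cl; auto.
      - apply Rmult_le_compat_l; [lra|auto]. }
  eapply Rle_trans; [|apply pairk_sum_lower].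
  apply Rplus_le_compat_r, Rmult_le_compat_l; [lra|].
  assert (Hind : forall b, 0 <= indic b <= 1).
  { intros b. rewrite indic_eq. destruct in_dec; lra. }
  assert (E : occ (seq 0 (S M)) indic o
              = occ (seq 0 N) indic o + occ (seq N (S M - N)) indic o).
  { unfold occ. rewrite <- rsum_app. f_equal.
    replace (S M) with (N + (S M - N))%nat at 1 by lia. apply seq_app. }
  (* Discarding the times before [N] loses at most one unit of occupation per time. *)
  assert (HN : occ (seq 0 N) indic o <= INR N).
  { unfold occ. rewrite <- (length_seq N 0) at 2. rewrite <- (Rmult_1_r (INR _)), <- rsum_const.
    apply rsum_le. intros t _. apply killn_le1. apply Hind. }
  assert (Hsub : u o <= occ (seq 0 (S M)) indic o + U * killn (S M) inB o).
  { apply occ_subsolution with cl; auto. apply Hind. }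
  assert (Hsup : INR (S M) * killn (S M) inB o <= f o).
  { eapply Rle_trans; [apply survival_le|]. apply occ_supersolution with cl; auto.
    - intros a Ba. unfold inB. now rewrite Ba.
    - intros a _ Ba. unfold inB. rewrite Ba. auto. }
  assert (P : 0 < INR (S M)) by (apply lt_0_INR; lia).
  assert (U * killn (S M) inB o <= U * f o / INR (S M)).
  { unfold Rdiv. rewrite Rmult_assoc. apply Rmult_le_compat_l; [easy|].
    apply Rmult_le_reg_l with (1 := P).
    replace (INR (S M) * (f o * / INR (S M))) with (f o) by (field; lra). easy. }
  lra.
Qed.

End KilledWalk.

(** * Combs over the line *)

Section CombZline.
Variables (nH : nat -> list nat).
Hypothesis H_simple : simple_graph nH.
Let nb := comb Zline nH 0.

Lemma comb_nonempty : (forall k, nH k <> []) -> forall a, nb a <> [].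
Proof.
  intros H [x k]. unfold nb, comb. specialize (H k). destruct (nH k); [easy|].
  discriminate.
Qed.

Lemma in_comb x k y k' :
  In (y, k') (nb (x, k)) <->
  (y = x /\ In k' (nH k)) \/ (k = 0%nat /\ k' = 0%nat /\ (y = x - 1 \/ y = x + 1)%Z).
Proof.
  unfold nb, comb. rewrite in_app_iff, in_map_iff. split.
  - intros [(z & [= <- <-] & Hz)|H]; [now left|].
    destruct (Nat.eqb_spec k 0) as [->|_]; [|easy].
    cbn in H. destruct H as [[= <- <-]|[[= <- <-]|[]]]; auto.
  - intros [[-> H]|(-> & -> & Hy)]; [left; now exists k'|].
    right. cbn. destruct Hy as [->| ->]; auto.
Qed.

Lemma comb_nodup a : NoDup (nb a).
Proof.
  destruct a as [x k]. destruct H_simple as (Hnd & _ & _). unfold nb, comb.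
  apply NoDup_app.
  - apply Injective_map_NoDup; [|apply Hnd]. intros u v [=]; easy.
  - destruct (Nat.eqb k 0); [|constructor]. cbn.
    constructor; [|constructor; [easy|constructor]].
    intros [[=]|[]]. lia.
  - intros [y k'] H1 H2. apply in_map_iff in H1. destruct H1 as (z & [= <- <-] & _).
    destruct (Nat.eqb k 0); [|easy]. cbn in H2.
    destruct H2 as [[=]|[[=]|[]]]; lia.
Qed.

Lemma comb_sym a b : In b (nb a) -> In a (nb b).
Proof.
  destruct H_simple as (_ & _ & Hs). destruct a as [x k], b as [y k']. rewrite !in_comb.
  intros [[-> H]|(-> & -> & [->| ->])]; [left; auto| |]; right; repeat split; lia.
Qed.

End CombZline.


(** * The hairy ray and the comb built from it *)

Section HairyRay.
Variable ell : nat -> nat.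

(* The vertices [(i, j)], [j <= ell i], are numbered lexicographically: [(i, 0)] is the
   spine and [(i, 1)], ..., [(i, ell i)] the hair hanging at [(i, 0)]. *)
Definition next (q : nat * nat) : nat * nat :=
  let (i, j) := q in if (j <? ell i)%nat then (i, S j) else (S i, O).

Definition coords (k : nat) : nat * nat := Nat.iter k next (O, O).

Fixpoint root (i : nat) : nat :=
  match i with O => O | S i' => root i' + S (ell i') end.

Definition enc (q : nat * nat) : nat := root (fst q) + snd q.

Definition valid (q : nat * nat) : Prop := (snd q <= ell (fst q))%nat.

Lemma coords_enc q : valid q -> coords (enc q) = q.
Proof.
  destruct q as [i j]. unfold valid, enc; cbn [fst snd]. revert j.
  assert (Hhair : forall i, coords (root i) = (i, O) ->
    forall j, (j <= ell i)%nat -> coords (root i + j) = (i, j)).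
  { clear i. intros i Hi j. induction j as [|j IH]; intros Hj; [rewrite Nat.add_0_r; exact Hi|].
    rewrite Nat.add_succ_r. change (next (coords (root i + j)) = (i, S j)).
    rewrite IH by lia. cbn. destruct (Nat.ltb_spec j (ell i)); [easy|lia]. }
  apply Hhair. induction i as [|i IH]; [easy|].
  cbn [root]. rewrite Nat.add_succ_r. change (next (coords (root i + ell i)) = (S i, O)).
  rewrite (Hhair i IH) by lia. cbn. now rewrite Nat.ltb_irrefl.
Qed.

Lemma coords_spec k : valid (coords k) /\ enc (coords k) = k.
Proof.
  induction k as [|k [Hv He]]; [split; [unfold valid; cbn; lia|easy]|].
  change (coords (S k)) with (next (coords k)). destruct (coords k) as [i j].
  unfold valid, enc in *. cbn in *. destruct (Nat.ltb_spec j (ell i)); cbn; lia.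
Qed.

Lemma coords_inj k k' : coords k = coords k' -> k = k'.
Proof. intros E. now rewrite <- (proj2 (coords_spec k)), <- (proj2 (coords_spec k')), E. Qed.

Definition nbq (q : nat * nat) : list (nat * nat) :=
  let (i, j) := q in
  (if (j <? ell i)%nat then [(i, S j)] else []) ++
  match j with
  | S j' => [(i, j')]
  | O => (S i, O) :: match i with S i' => [(i', O)] | O => [] end
  end.

Definition hairy_ray (k : nat) : list nat := map enc (nbq (coords k)).

Lemma nbq_valid q q' : valid q -> In q' (nbq q) -> valid q'.
Proof.
  destruct q as [i j], q' as [i' j']. unfold valid. cbn.
  rewrite in_app_iff. destruct (Nat.ltb_spec j (ell i)), j as [|j], i as [|i]; cbn;
  intuition; repeat match goal with H : (_, _) = (_, _) |- _ => injection H as <- <- end; lia.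
Qed.

Lemma nbq_sym q q' : valid q -> In q' (nbq q) -> In q (nbq q').
Proof.
  destruct q as [i j], q' as [i' j']. unfold valid. cbn [nbq fst snd].
  rewrite !in_app_iff. intros Hv [H|H].
  - destruct (Nat.ltb_spec j (ell i)); [|easy].
    destruct H as [[= <- <-]|[]]. right. now left.
  - destruct j as [|j].
    + destruct H as [[= <- <-]|H]; [right; right; now left|].
      destruct i as [|i]; [easy|]. destruct H as [[= <- <-]|[]]. right. now left.
    + destruct H as [[= <- <-]|[]]. left. destruct (Nat.ltb_spec j (ell i)); [now left|lia].
Qed.

Lemma nbq_nodup q : NoDup (nbq q).
Proof.
  destruct q as [i j]. cbn.
  destruct (j <? ell i)%nat, j as [|j], i as [|i]; cbn; repeat constructor; cbn;
    intuition; repeat match goal with H : (_, _) = (_, _) |- _ => injection H; clear H; intros end; lia.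
Qed.

Lemma nbq_irrefl q : ~ In q (nbq q).
Proof.
  destruct q as [i j]. cbn. rewrite in_app_iff.
  destruct (j <? ell i)%nat, j as [|j], i as [|i]; cbn;
    intuition; repeat match goal with H : (_, _) = (_, _) |- _ => injection H; clear H; intros end; lia.
Qed.

Lemma in_hairy_ray k k' : In k' (hairy_ray k) <-> In (coords k') (nbq (coords k)).
Proof.
  unfold hairy_ray. rewrite in_map_iff. split.
  - intros (q & <- & Hq). rewrite coords_enc; [easy|].
    apply nbq_valid with (coords k); [apply coords_spec|easy].
  - intros H. exists (coords k'). split; [apply coords_spec|easy].
Qed.

Lemma hairy_ray_simple : simple_graph hairy_ray.
Proof.
  repeat split.
  - intros k. apply (NoDup_map_inv coords). unfold hairy_ray.
    rewrite map_map, (map_ext_in _ (fun q => q)), map_id; [apply nbq_nodup|].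
    intros q Hq. apply coords_enc, nbq_valid with (coords k); [apply coords_spec|easy].
  - intros k. rewrite in_hairy_ray. apply nbq_irrefl.
  - intros k k'. rewrite !in_hairy_ray. apply nbq_sym, coords_spec.
Qed.

Lemma hairy_ray_bounded : bounded_degree hairy_ray.
Proof.
  exists 3%nat. intros k. unfold hairy_ray. rewrite length_map.
  destruct (coords k) as [i j]. cbn. destruct (j <? ell i)%nat, j, i; cbn; lia.
Qed.

Lemma hairy_ray_connected : connected hairy_ray.
Proof.
  assert (Hsym : forall x y, clos_refl_trans _ (adj hairy_ray) x y ->
                        clos_refl_trans _ (adj hairy_ray) y x).
  { intros x y H. induction H.
    - apply rt_step. now apply hairy_ray_simple.
    - apply rt_refl.
    - eapply rt_trans; eassumption. }
  assert (Hspine : forall i, clos_refl_trans _ (adj hairy_ray) (enc (O, O)) (enc (i, O))).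
  { induction i as [|i IH]; [apply rt_refl|]. eapply rt_trans; [exact IH|]. apply rt_step.
    unfold adj. rewrite in_hairy_ray, !coords_enc by (unfold valid; cbn; lia).
    cbn. apply in_app_iff. right. now left. }
  assert (H0 : forall k, clos_refl_trans _ (adj hairy_ray) (enc (O, O)) k).
  { intros k. rewrite <- (proj2 (coords_spec k)).
    destruct (coords_spec k) as [Hv _]. destruct (coords k) as [i j]. revert Hv.
    unfold valid. cbn [fst snd]. induction j as [|j IH]; intros Hv; [apply Hspine|].
    eapply rt_trans; [apply IH; lia|]. apply rt_step.
    unfold adj. rewrite in_hairy_ray, !coords_enc by (unfold valid; cbn; lia).
    cbn. apply in_app_iff. left. destruct (Nat.ltb_spec j (ell i)); [now left|lia]. }
  intros x y. eapply rt_trans; [apply Hsym, H0|apply H0].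
Qed.

Lemma hairy_ray_nonempty k : hairy_ray k <> [].
Proof.
  unfold hairy_ray. destruct (coords k) as [i j]. cbn.
  destruct (j <? ell i)%nat, j, i; discriminate.
Qed.

Definition lift (F : Z -> nat -> nat -> R) (p : Z * nat) : R :=
  F (fst p) (fst (coords (snd p))) (snd (coords (snd p))).

Notation nbc := (comb Zline hairy_ray 0).

Lemma deg_comb_le a : deg nbc a <= 4.
Proof.
  replace 4 with (INR 4) by (simpl; ring). apply le_INR.
  destruct a as [x k]. unfold comb. rewrite length_app, length_map.
  unfold hairy_ray. rewrite length_map.
  destruct (Nat.eqb_spec k 0) as [->|_].
  - cbn. destruct (0 <? ell 0)%nat; cbn; lia.
  - destruct (coords k) as [i j]. cbn. destruct (j <? ell i)%nat, j, i; cbn; lia.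
Qed.

Lemma lap_comb (F : Z -> nat -> nat -> R) x k i j : coords k = (i, j) ->
  lap nbc (lift F) (x, k) =
  (if (j <? ell i)%nat then F x i j - F x i (S j) else 0) +
  match j with
  | S j' => F x i j - F x i j'
  | O => F x i O - F x (S i) O +
         match i with
         | S i' => F x i O - F x i' O
         | O => 2 * F x O O - F (x - 1)%Z O O - F (x + 1)%Z O O
         end
  end.
Proof.
  intros E. unfold lap, comb. rewrite rsum_app, rsum_map. unfold hairy_ray at 1.
  rewrite rsum_map.
  rewrite (rsum_ext _ _ (fun q => F x i j - F x (fst q) (snd q))).
  2:{ intros q Hq. unfold lift. cbn [fst snd].
      rewrite coords_enc, E; [easy|].
      apply nbq_valid with (coords k); [apply coords_spec|easy]. }
  rewrite E. cbn [nbq]. rewrite rsum_app.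
  assert (Ek : k = enc (i, j)) by (rewrite <- E; symmetry; apply coords_spec).
  (* Number 0 belongs to the coordinates [(0, 0)] alone, so base edges appear only there. *)
  assert (Hk : (k =? 0)%nat = (match i, j with O, O => true | _, _ => false end)).
  { rewrite Ek. unfold enc. cbn [fst snd].
    destruct i as [|i], j as [|j]; cbn [root]; apply Nat.eqb_eq || apply Nat.eqb_neq; lia. }
  rewrite Hk. destruct (j <? ell i)%nat, i as [|i], j as [|j]; unfold lift, rsum;
    cbn -[Z.add Z.sub coords]; rewrite ?E; change (coords 0) with (O, O); cbn [fst snd]; ring.
Qed.

End HairyRay.

(** Spine potentials are given through their increments: the spine part of the Laplacian at [S i] is
    then [g i - g (S i)]. *)
Fixpoint psum (g : nat -> R) (i : nat) : R :=
  match i with O => 0 | S i' => psum g i' + g i' end.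

(* The mean exit time profile of a hair of length [l]: unit Laplacian at every site of the
   hair, the tip included. *)
Definition hairp (l j : nat) : R := INR j * (2 * INR l + 1 - INR j) / 2.

Lemma hairp_S l j : hairp l (S j) - hairp l j = INR l - INR j.
Proof. unfold hairp. rewrite S_INR. field. Qed.

Lemma hairp_bounds l j : (j <= l)%nat -> 0 <= hairp l j <= INR l * INR l.
Proof.
  intros H. unfold hairp. destruct j as [|j]; [simpl; split; nra|].
  apply le_INR in H. rewrite S_INR in *. pose proof (pos_INR j). split; nra.
Qed.

(** * One scale: the box, its boundary and the slab *)

Section Scale.
Variables (ell : nat -> nat) (w : nat).
Hypothesis w_ge4 : (4 <= w)%nat.
Hypothesis ell_0 : ell 0 = 0%nat.
Hypothesis ell_le : forall i, (i < 2 * w)%nat -> (ell i <= w)%nat.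
Hypothesis ell_eq : forall i, (w <= i < 2 * w)%nat -> ell i = w.
Hypothesis ell_gap : forall i, (2 * w <= i < 2 * w + w * w)%nat -> ell i = 0%nat.

Let W := INR w.
Let e := (2 * w + w * w)%nat.
Let nb := comb Zline (hairy_ray ell) 0.
Let crd := coords ell.

Lemma W_ge4 : 4 <= W.
Proof. unfold W. replace 4 with (INR 4) by (simpl; ring). now apply le_INR. Qed.

Definition box (a : Z * nat) : bool :=
  (Z.abs (fst a) <? Z.of_nat w)%Z && (fst (crd (snd a)) <? e)%nat.

(** Covers the box and its outer boundary. The sides [|x| = w] are entered only along the base and
    the far end [i = e] only along the spine; the last clause keeps out the hair at [e], whose
    length is unspecified. *)
Definition cbox (a : Z * nat) : Prop :=
  (Z.abs (fst a) <= Z.of_nat w)%Z /\ (fst (crd (snd a)) <= e)%nat /\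
  (Z.abs (fst a) = Z.of_nat w -> crd (snd a) = (O, O)) /\
  (fst (crd (snd a)) = e -> snd (crd (snd a)) = O).

Lemma box_iff x k : box (x, k) = true <->
  (Z.abs x < Z.of_nat w)%Z /\ (fst (crd k) < e)%nat.
Proof.
  unfold box. cbn [fst snd]. now rewrite andb_true_iff, Z.ltb_lt, Nat.ltb_lt.
Qed.

Lemma box_cbox a : box a = true -> cbox a.
Proof.
  destruct a as [x k]. rewrite box_iff. unfold cbox. cbn [fst snd].
  intros [H1 H2]. repeat split; try lia.
Qed.

Lemma box_nb_cbox a b : box a = true -> In b (nb a) -> cbox b.
Proof.
  destruct a as [x k], b as [y k']. rewrite box_iff. unfold nb. rewrite in_comb.
  unfold cbox. cbn [fst snd]. intros [H1 H2] [[-> H]|(-> & -> & H)].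
  - rewrite in_hairy_ray in H. fold crd in H. destruct (crd k) as [i j], (crd k') as [i' j'].
    cbn [nbq fst snd] in *. apply in_app_iff in H. destruct H as [H|H].
    + destruct (Nat.ltb_spec j (ell i)); [|easy]. destruct H as [[= <- <-]|[]].
      repeat split; lia.
    + destruct j as [|j].
      * destruct H as [[= <- <-]|H]; [repeat split; lia|].
        destruct i as [|i]; [easy|]. destruct H as [[= <- <-]|[]]. repeat split; lia.
      * destruct H as [[= <- <-]|[]]. repeat split; lia.
  - change (crd 0) with (O, O). cbn [fst snd]. repeat split; lia.
Qed.

Definition slab : list (Z * nat) :=
  nodup Znat_eq_dec
    (map (fun p => (fst p, enc ell (snd p)))
       (list_prod (map (fun n => Z.of_nat n - Z.of_nat w)%Z (seq 1 (2 * w - 1)))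
          (list_prod (seq w w) (seq 1 w)))).

Lemma in_slab x k : In (x, k) slab <->
  (Z.abs x < Z.of_nat w)%Z /\ (w <= fst (crd k) < 2 * w)%nat /\ (1 <= snd (crd k))%nat.
Proof.
  unfold slab. rewrite nodup_In, in_map_iff. split.
  - intros ([y [i j]] & [= <- <-] & H). rewrite !in_prod_iff, in_map_iff, !in_seq in H.
    destruct H as ((n & <- & Hn) & Hi & Hj). apply in_seq in Hn.
    unfold crd. rewrite coords_enc by (unfold valid; cbn; rewrite ell_eq; lia). cbn. lia.
  - intros (Hx & Hi & Hj). exists (x, crd k). cbn [fst snd].
    destruct (coords_spec ell k) as [Hv Hk]. unfold valid in Hv. fold crd in Hv, Hk.
    rewrite Hk. split; [easy|]. destruct (crd k) as [i j]. cbn [fst snd] in *.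
    rewrite ell_eq in Hv by lia.
    rewrite !in_prod_iff, in_map_iff, !in_seq. repeat split; try lia.
    exists (Z.to_nat (x + Z.of_nat w)). rewrite in_seq. lia.
Qed.

Lemma slab_box a : In a slab -> box a = true.
Proof. destruct a as [x k]. rewrite in_slab, box_iff. unfold e. lia. Qed.

Lemma slab_length : INR (length slab) <= 2 * W ^ 3.
Proof.
  apply Rle_trans with (INR (2 * w * (w * w))).
  - apply le_INR. transitivity ((2 * w - 1) * (w * w))%nat; [|nia].
    unfold slab. eapply Nat.le_trans.
    + exact (NoDup_incl_length (NoDup_nodup _ _) (fun a => proj1 (nodup_In _ _ a))).
    + rewrite length_map, !length_prod, length_map, !length_seq. lia.
  - rewrite !mult_INR. fold W. simpl. lra.
Qed.

Lemma ind_slab_ge0 a : 0 <= indic Znat_eq_dec slab a.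
Proof. rewrite indic_eq by apply NoDup_nodup. destruct in_dec; lra. Qed.

(** * Explicit potentials for the lifetime, the slab occupation and the Green function *)

Lemma solution_of_lap g h (a : Z * nat) :
  deg nb a * g <= lap nb h a -> g + avg nb h a <= h a.
Proof.
  assert (Hne : forall a, nb a <> []) by (apply comb_nonempty, hairy_ray_nonempty).
  rewrite lap_avg by easy. intros H. pose proof (deg_ge1 _ Hne a).
  apply Rmult_le_compat_l with (r := / deg nb a) in H; [|apply Rlt_le, Rinv_0_lt_compat; lra].
  rewrite <- !Rmult_assoc, Rinv_l in H by lra. lra.
Qed.

(** The increments of [hairp l] drop by one per site and reach zero at the tip, so the missing
    outward edge there changes nothing. *)
Lemma hair_lap (j l : nat) c : (S j <= l)%nat ->
  (if (S j <? l)%nat then c * hairp l (S j) - c * hairp l (S (S j)) else 0)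
  + (c * hairp l (S j) - c * hairp l j) = c.
Proof.
  intros H. pose proof (hairp_S l j). pose proof (hairp_S l (S j)).
  rewrite S_INR in *. destruct (Nat.ltb_spec (S j) l).
  - nra.
  - assert (E : l = S j) by lia. rewrite E in *. rewrite S_INR in *. nra.
Qed.

Lemma hair_root_lap (l : nat) c :
  (if (0 <? l)%nat then c * hairp l 0 - c * hairp l 1 else 0) = - c * INR l.
Proof.
  pose proof (hairp_S l 0). cbn [INR] in *. destruct (Nat.ltb_spec 0 l).
  - nra.
  - replace l with O by lia. simpl. ring.
Qed.

(** Each drop of this slope pays 4 for a spine vertex, the largest degree in the comb, and for
    [i < 2 * w] a further [4 * W] for its hair. The initial value makes the slope vanish exactly at
    [i = e]. *)
Definition fslope (i : nat) : R :=
  12 * W ^ 2 + 8 * W - 4 * INR i - 4 * W * INR (Nat.min i (2 * w)).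

(** Upper bound for the mean lifetime, with Laplacian at least 4 in the box. Twice the base
    coefficient is [fslope 0 + 4], which balances the spine increment at the foot of a tooth. *)
Definition fpot (x : Z) (i j : nat) : R :=
  (6 * W ^ 2 + 4 * W + 2) * (W ^ 2 - IZR x ^ 2) + psum fslope i + 4 * hairp (ell i) j.

Lemma fslope_nonneg i : (i < e)%nat -> 0 <= fslope i.
Proof.
  intros H. unfold fslope.
  assert (INR i <= 2 * W + W * W).
  { apply Rle_trans with (INR e); [apply le_INR; lia|].
    unfold e. rewrite plus_INR, !mult_INR. fold W. simpl. lra. }
  assert (INR (Nat.min i (2 * w)) <= 2 * W).
  { apply Rle_trans with (INR (2 * w)); [apply le_INR; lia|].
    rewrite mult_INR. fold W. simpl. lra. }
  pose proof W_ge4. nra.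
Qed.

Lemma psum_fslope_nonneg i : (i <= e)%nat -> 0 <= psum fslope i.
Proof.
  induction i as [|i IH]; intros H; simpl; [lra|].
  specialize (IH ltac:(lia)).
  assert (0 <= fslope i) by (apply fslope_nonneg; lia). lra.
Qed.

Lemma sq_le_W x : (Z.abs x <= Z.of_nat w)%Z -> IZR x ^ 2 <= W ^ 2.
Proof.
  intros H. apply IZR_le in H. rewrite <- INR_IZR_INZ, abs_IZR in H. fold W in H.
  apply pow_maj_Rabs. lra.
Qed.

Lemma fpot_nonneg a : cbox a -> 0 <= lift ell fpot a.
Proof.
  destruct a as [x k]. unfold cbox, lift, fpot. cbn [fst snd]. intros (Hx & Hi & _).
  pose proof (sq_le_W x Hx). pose proof (psum_fslope_nonneg _ Hi).
  destruct (hairp_bounds _ _ (proj1 (coords_spec ell k))). unfold crd in *.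
  pose proof W_ge4. nra.
Qed.

Lemma fpot_super a : box a = true -> 1 + avg nb (lift ell fpot) a <= lift ell fpot a.
Proof.
  destruct a as [x k]. rewrite box_iff. intros [Hx Hi]. apply solution_of_lap.
  apply Rle_trans with 4; [pose proof (deg_comb_le ell (x, k)); unfold nb; lra|].
  destruct (coords_spec ell k) as [Hv _]. unfold valid in Hv. fold crd in Hv.
  destruct (crd k) as [i j] eqn:E. cbn [fst snd] in *.
  unfold nb. rewrite (lap_comb ell fpot x k i j E).
  destruct j as [|j].
  - assert (Hhair : (if (0 <? ell i)%nat then fpot x i 0 - fpot x i 1 else 0)
       = - 4 * INR (ell i)).
    { pose proof (hair_root_lap (ell i) 4). unfold fpot. destruct (0 <? ell i)%nat; lra. }
    rewrite Hhair. destruct i as [|i].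
    + rewrite ell_0. unfold fpot. cbn [psum]. rewrite minus_IZR, plus_IZR.
      unfold fslope, hairp. simpl. lra.
    (* For [i < 2 * w] the drop is [4 + 4 * W], and [S i] is at most [2 * w], where the gap
       begins. *)
    + assert (Hs : fslope i - fslope (S i) >= 4 + 4 * INR (ell (S i))).
      { unfold fslope. rewrite S_INR. destruct (le_lt_dec (2 * w) i).
        - rewrite ell_gap by (unfold e in *; lia). rewrite !Nat.min_r by lia. simpl. lra.
        - rewrite !Nat.min_l, S_INR by lia.
          assert (INR (ell (S i)) <= W).
          { apply le_INR. destruct (Nat.eq_dec (S i) (2 * w)).
            - rewrite ell_gap; nia.
            - apply ell_le. lia. }
          nra. }
      unfold fpot, hairp. cbn [psum INR]. lra.
  - rewrite <- (hair_lap j (ell i) 4 Hv) at 1. unfold fpot.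
    destruct (S j <? ell i)%nat; lra.
Qed.

Lemma fpot_origin : fpot 0 0 0 <= 12 * W ^ 4.
Proof.
  unfold fpot, hairp. cbn [psum INR]. pose proof W_ge4. simpl pow.
  assert (0 <= W * W) by nra. nra.
Qed.

(** The slope is [W ^ 2 / 2] below [w], where the subtraction truncates to 0, loses [W] at each
    spine vertex of [[w, 2w)], and is [- W ^ 2 / 2] along the gap. *)
Definition uslope (i : nat) : R := W ^ 2 / 2 - W * INR (Nat.min (S i - w) w).

(** Lower bound for the mean time in the slab: in the box its Laplacian is the indicator of the
    slab. The base coefficient is half of [uslope 0], which gives harmonicity at the foot of a
    tooth. *)
Definition upot (x : Z) (i j : nat) : R :=
  W ^ 2 / 4 * (W ^ 2 - IZR x ^ 2) + psum uslope i +
  (if (w <=? i)%nat && (i <? 2 * w)%nat then 1 else 0) * hairp (ell i) j.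

Lemma psum_uslope_le i : psum uslope i <= W ^ 2 / 2 * INR (Nat.min i (2 * w)).
Proof.
  pose proof W_ge4. induction i as [|i IH]; [simpl; lra|]. cbn [psum]. unfold uslope at 2.
  destruct (le_lt_dec (2 * w) i).
  - rewrite (Nat.min_r (S i - w)) by lia. rewrite (Nat.min_r (S i)) by lia.
    rewrite Nat.min_r in IH by lia. fold W. nra.
  - rewrite (Nat.min_l (S i)), S_INR by lia. rewrite Nat.min_l in IH by lia.
    assert (0 <= W * INR (Nat.min (S i - w) w))
      by (apply Rmult_le_pos; [lra|apply pos_INR]).
    lra.
Qed.

Lemma psum_uslope_bound i : psum uslope i <= W ^ 3.
Proof.
  eapply Rle_trans; [apply psum_uslope_le|].
  assert (INR (Nat.min i (2 * w)) <= 2 * W).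
  { apply Rle_trans with (INR (2 * w)); [apply le_INR; lia|].
    rewrite mult_INR. fold W. simpl. lra. }
  pose proof W_ge4. simpl pow. nra.
Qed.

Lemma psum_uslope_end n : psum uslope (2 * w + n) <= W ^ 3 - INR n * (W ^ 2 / 2).
Proof.
  induction n as [|n IH].
  - rewrite Nat.add_0_r. pose proof (psum_uslope_bound (2 * w)). cbn [INR]. lra.
  - rewrite Nat.add_succ_r. cbn [psum]. unfold uslope at 2.
    rewrite Nat.min_r by lia. fold W. rewrite S_INR. nra.
Qed.

Lemma upot_le a : cbox a -> lift ell upot a <= W ^ 4 * inB box a.
Proof.
  pose proof W_ge4 as HW.
  destruct a as [x k]. intros (Hx & Hi & Hxe & Hie). cbn [fst snd] in *.
  pose proof (coords_spec ell k) as [Hv _]. unfold valid in Hv. fold crd in Hv.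
  pose proof (pow2_ge_0 (IZR x)) as Hx2.
  unfold lift. cbn [fst snd]. fold crd. unfold upot.
  set (i := fst (crd k)) in *. set (j := snd (crd k)) in *.
  assert (Hhair : (if (w <=? i)%nat && (i <? 2 * w)%nat then 1 else 0) * hairp (ell i) j <= W ^ 2).
  { destruct (hairp_bounds _ _ Hv) as [H0 H1].
    destruct (Nat.leb_spec w i), (Nat.ltb_spec i (2 * w)); cbn [andb]; try nra.
    rewrite ell_eq in * by lia. fold W in H1. nra. }
  unfold inB. destruct (box (x, k)) eqn:Eb.
  - pose proof (psum_uslope_bound i).
    assert (W ^ 3 <= W ^ 4 / 4) by (simpl pow; assert (0 <= W * (W * W)) by nra; nra).
    assert (W ^ 2 <= W ^ 4 / 4) by (simpl pow; assert (0 <= (W * W)) by nra; nra).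
    assert (W ^ 2 / 4 * (W ^ 2 - IZR x ^ 2) <= W ^ 4 / 4)
      by (assert (0 <= W ^ 2) by nra; simpl pow in *; nra).
    pose proof (pow2_ge_0 W). lra.
  - rewrite Rmult_0_r. destruct (Z.eq_dec (Z.abs x) (Z.of_nat w)) as [Ex|Nx].
    + assert (Ec : crd k = (O, O)) by auto. unfold i, j in *. rewrite Ec in *. cbn [fst snd] in *.
      replace (IZR x ^ 2) with (W ^ 2).
      * unfold hairp. cbn [psum INR]. lra.
      * unfold W. rewrite INR_IZR_INZ, <- Ex, abs_IZR. apply pow2_abs.
    + assert (Ei : i = e).
      { destruct (Nat.eq_dec i e) as [|Ne]; [easy|]. rewrite <- not_true_iff_false in Eb.
        elim Eb. apply box_iff. fold i. lia. }
      rewrite (Hie Ei), Ei.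
      replace (hairp (ell e) 0) with 0 by (unfold hairp; simpl; field).
      (* Here the length of the gap enters: [w * w] steps of slope [- W ^ 2 / 2] cost [W ^ 4 / 2],
         outweighing [W ^ 3] and the base part, each at most [W ^ 4 / 4]. *)
      pose proof (psum_uslope_end (w * w)) as Hend. fold e in Hend.
      rewrite mult_INR in Hend. fold W in Hend.
      assert (W ^ 3 <= W ^ 4 / 4) by (simpl pow; assert (0 <= W * (W * W)) by nra; nra).
      assert (W ^ 2 / 4 * (W ^ 2 - IZR x ^ 2) <= W ^ 4 / 4)
        by (assert (0 <= W ^ 2) by nra; simpl pow in *; nra).
      replace (W * W * (W ^ 2 / 2)) with (W ^ 4 / 2) in Hend by field.
      lra.
Qed.

Lemma upot_sub a : box a = true ->
  lift ell upot a <= indic Znat_eq_dec slab a + avg nb (lift ell upot) a.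
Proof.
  destruct a as [x k]. intros Hb. pose proof Hb as Hb'. apply box_iff in Hb'. destruct Hb' as [Hx Hi].
  assert (Hlap : lap nb (lift ell upot) (x, k) <= indic Znat_eq_dec slab (x, k)).
  { rewrite indic_eq by apply NoDup_nodup.
    destruct (coords_spec ell k) as [Hv _]. unfold valid in Hv. fold crd in Hv.
    pose proof (in_slab x k) as Hs. destruct (crd k) as [i j] eqn:E. cbn [fst snd] in *.
    unfold nb. rewrite (lap_comb ell upot x k i j E).
    set (c := if (w <=? i)%nat && (i <? 2 * w)%nat then 1 else 0).
    destruct j as [|j].
    - assert (Hhair : (if (0 <? ell i)%nat then upot x i 0 - upot x i 1 else 0)
         = - c * INR (ell i)).
      { pose proof (hair_root_lap (ell i) c). unfold upot. fold c. destruct (0 <? ell i)%nat; lra. }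
      rewrite Hhair. apply Rle_trans with 0; [|destruct in_dec; lra].
      destruct i as [|i].
      + rewrite ell_0. unfold upot. cbn [psum]. rewrite minus_IZR, plus_IZR.
        unfold uslope, hairp. replace (1 - w)%nat with O by lia. simpl. lra.
      + assert (Hd : uslope i - uslope (S i) = c * INR (ell (S i))).
        { unfold uslope, c.
          destruct (Nat.leb_spec w (S i)), (Nat.ltb_spec (S i) (2 * w)); cbn [andb]; try lia.
          - rewrite ell_eq by lia. fold W. rewrite !Nat.min_l by lia.
            replace (S (S i) - w)%nat with (S (S i - w)) by lia. rewrite S_INR. ring.
          - rewrite !Nat.min_r by lia. ring.
          - replace (S i - w)%nat with O by lia.
            replace (S (S i) - w)%nat with O by lia. ring. }
        unfold upot, hairp. cbn [psum INR]. lra.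
    - pose proof (hair_lap j (ell i) c Hv) as Hc.
      apply Rle_trans with c.
      + rewrite <- Hc. unfold upot. fold c. destruct (S j <? ell i)%nat; lra.
      + unfold c. destruct (Nat.leb_spec w i), (Nat.ltb_spec i (2 * w)); cbn [andb];
          destruct in_dec as [Hin|Hn]; try lra.
        elim Hn. apply Hs. lia. }
  assert (Hne : forall a, nb a <> []) by (apply comb_nonempty, hairy_ray_nonempty).
  rewrite lap_avg in Hlap by easy. pose proof (deg_ge1 _ Hne (x, k)).
  pose proof (ind_slab_ge0 (x, k)).
  (* A positive Laplacian only shrinks when divided by the degree; otherwise the indicator being
     nonnegative suffices. *)
  destruct (Rle_dec (lift ell upot (x, k)) (avg nb (lift ell upot) (x, k))); nra.
Qed.

(* The distance from [(0, 0)] to the branch point of [(i, j)] and [(i0, j0)] in the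
   hairy ray. *)
Definition meet (i0 j0 i j : nat) : nat :=
  Nat.min i i0 + if Nat.eq_dec i i0 then Nat.min j j0 else 0.

(* Up to the factor 4, the potential of a unit current entering at [z] and leaving
   through the two ends of the base. *)
Definition hpot (z : Z * nat) (x : Z) (i j : nat) : R :=
  4 * (2 * W - Rabs (IZR x - IZR (fst z)) +
       if Z.eq_dec x (fst z)
       then INR (meet (fst (crd (snd z))) (snd (crd (snd z))) i j) else 0).

Lemma hpot_nonneg z a : In z slab -> cbox a -> 0 <= lift ell (hpot z) a.
Proof.
  destruct z as [x0 k0], a as [x k]. rewrite in_slab. intros (Hx0 & _) (Hx & _).
  unfold lift, hpot. cbn [fst snd] in *.
  assert (Rabs (IZR x - IZR x0) <= 2 * W).
  { rewrite <- minus_IZR, <- abs_IZR. unfold W. rewrite INR_IZR_INZ, <- mult_IZR.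
    apply IZR_le. lia. }
  destruct Z.eq_dec; [|lra].
  match goal with |- context [INR ?n] => pose proof (pos_INR n) end. lra.
Qed.

Lemma hpot_diag z : In z slab -> lift ell (hpot z) z <= 20 * W.
Proof.
  destruct z as [x k]. rewrite in_slab. intros (_ & Hi & _).
  destruct (coords_spec ell k) as [Hv _]. unfold valid in Hv. fold crd in Hv.
  unfold lift, hpot. cbn [fst snd]. fold crd.
  replace (IZR x - IZR x) with 0 by ring. rewrite Rabs_R0.
  destruct Z.eq_dec; [|easy].
  (* The spine part is below [2 * w] and the hair part at most [w]. *)
  assert (INR (meet (fst (crd k)) (snd (crd k)) (fst (crd k)) (snd (crd k))) <= 3 * W).
  { unfold W. replace 3 with (INR 3) by (simpl; ring). rewrite <- mult_INR. apply le_INR.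
    unfold meet. rewrite ell_eq in Hv by lia. destruct Nat.eq_dec; lia. }
  lra.
Qed.

Lemma hpot_super z a : In z slab -> box a = true ->
  delta Znat_eq_dec z a + avg nb (lift ell (hpot z)) a <= lift ell (hpot z) a.
Proof.
  destruct a as [x k]. intros Hz. rewrite box_iff. intros [Hx Hi]. apply solution_of_lap.
  destruct z as [x0 k0]. apply in_slab in Hz. destruct Hz as (Hx0 & Hi0 & Hj0).
  apply Rle_trans with (4 * delta Znat_eq_dec (x0, k0) (x, k)).
  { apply Rmult_le_compat_r; [apply delta_nonneg|apply deg_comb_le]. }
  destruct (coords_spec ell k0) as [Hv0 _]. unfold valid in Hv0. fold crd in Hv0.
  destruct (coords_spec ell k) as [Hv _]. unfold valid in Hv. fold crd in Hv.
  (* The point mass at [z] within its tooth, as a natural number, so that the inequalities on [meet]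
     stay in linear integer arithmetic. *)
  set (D := if Nat.eq_dec (fst (crd k)) (fst (crd k0)) then
      (if Nat.eq_dec (snd (crd k)) (snd (crd k0)) then 1%nat else 0%nat) else 0%nat).
  assert (Hd : delta Znat_eq_dec (x0, k0) (x, k) = if Z.eq_dec x x0 then INR D else 0).
  { unfold delta, D. destruct (Znat_eq_dec (x, k) (x0, k0)) as [[= <- <-]|Hne].
    - destruct Z.eq_dec; [|easy]. do 2 (destruct Nat.eq_dec; [|easy]). easy.
    - destruct Z.eq_dec as [<-|]; [|easy].
      destruct Nat.eq_dec as [Ei|]; [|easy]. destruct Nat.eq_dec as [Ej|]; [|easy].
      elim Hne. f_equal. apply (coords_inj ell). fold crd.
      now apply injective_projections. }
  rewrite Hd. clear Hd.
  destruct (crd k) as [i j] eqn:E. unfold nb. rewrite (lap_comb ell _ x k i j E).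
  unfold hpot. cbn [fst snd]. destruct (crd k0) as [i0 j0]. cbn [fst snd] in *.
  set (m := meet i0 j0).
  assert (Hm : forall a b c d p, (a + b + c + p <= d)%nat ->
                INR a + INR b + INR c + INR p <= INR d).
  { intros * H. rewrite <- !plus_INR. now apply le_INR. }
  destruct (Z.eq_dec x x0) as [<-|Nx].
  - replace (IZR x - IZR x) with 0 by ring. rewrite Rabs_R0.
    destruct j as [|j]; [destruct i as [|i]|].
    (* Foot of the tooth of [z]: the two base edges descend by 1 each, against a rise of at most 1
       along the spine. *)
    + destruct (Nat.ltb_spec 0 (ell 0)); [lia|].
      destruct (Z.eq_dec (x - 1) x) as [|_]; [lia|].
      destruct (Z.eq_dec (x + 1) x) as [|_]; [lia|].
      rewrite minus_IZR, plus_IZR.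
      replace (IZR x - 1 - IZR x) with (- (1)) by ring.
      replace (IZR x + 1 - IZR x) with 1 by ring. rewrite Rabs_Ropp, Rabs_R1.
      assert (H1 : (m 1 0 + 0 + 0 + D <= 1)%nat)
        by (unfold m, meet, D; repeat destruct Nat.eq_dec; lia).
      apply Hm in H1. pose proof (pos_INR (m 0%nat 0%nat)). cbn [INR] in *. lra.
    (* [meet] gains 1 per edge towards [z] and is constant on side branches, so away from [z] the
       gain forward never exceeds the loss backward. *)
    + assert (H1 : (m (S i) 1 + m (S (S i)) 0 + m i 0 + D <= 3 * m (S i) 0)%nat)
        by (unfold m, meet, D; repeat destruct Nat.eq_dec; lia).
      assert (H2 : (m (S (S i)) 0 + m i 0 + 0 + D <= 2 * m (S i) 0)%nat \/ (0 < ell (S i))%nat)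
        by (unfold m, meet, D; repeat destruct Nat.eq_dec; subst; lia).
      apply Hm in H1. rewrite mult_INR in H1.
      destruct (Nat.ltb_spec 0 (ell (S i))).
      * simpl INR in *. lra.
      * destruct H2 as [H2|]; [|lia]. apply Hm in H2. rewrite mult_INR in H2.
        simpl INR in *. lra.
    + destruct (Nat.ltb_spec (S j) (ell i)).
      * assert (H1 : (m i (S (S j)) + m i j + 0 + D <= 2 * m i (S j))%nat)
          by (unfold m, meet, D; repeat destruct Nat.eq_dec; lia).
        apply Hm in H1. rewrite mult_INR in H1. simpl INR in *. lra.
      * assert (H1 : (m i j + 0 + 0 + D <= m i (S j))%nat)
          by (unfold m, meet, D; repeat destruct Nat.eq_dec; subst; lia).
        apply Hm in H1. simpl INR in *. lra.
  - rewrite Rmult_0_r.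
    assert (Hbase : 2 * Rabs (IZR x - IZR x0) <=
      Rabs (IZR (x - 1) - IZR x0) + Rabs (IZR (x + 1) - IZR x0)).
    { rewrite minus_IZR, plus_IZR.
      pose proof (Rabs_triang (IZR x - 1 - IZR x0) (IZR x + 1 - IZR x0)) as T.
      replace (IZR x - 1 - IZR x0 + (IZR x + 1 - IZR x0)) with (2 * (IZR x - IZR x0)) in T
        by ring.
      rewrite Rabs_mult, (Rabs_right 2) in T by lra. lra. }
    (* [meet] vanishes at the foot of the tooth of [z], so on the base the potential is just the
       concave function of [x]. *)
    replace (m 0%nat 0%nat) with 0%nat by (unfold m, meet; destruct (Nat.eq_dec 0 i0); lia).
    cbn [INR].
    destruct (j <? ell i)%nat, j as [|j], i as [|i]; try lra;
      destruct (Z.eq_dec (x - 1) x0), (Z.eq_dec (x + 1) x0); lra.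
Qed.

(** * Uniform collision bound at one scale *)

Lemma hairy_comb_collision N : (16 * N <= w)%nat ->
  exists M, (N <= M)%nat /\ / 3932160 <= collision_prob nb Znat_eq_dec (0%Z, O) (0%Z, O) N M.
Proof.
  intros HN. pose proof W_ge4 as HW.
  (* With [fpot 0 0 0 <= 12 * W ^ 4], the factor 96 brings the survival loss down to [W ^ 4 / 8]. Of
     the occupation [W ^ 4 / 4], at least [W ^ 4 / 16] is left after the loss [INR N]. *)
  set (M := (96 * w ^ 4 - 1)%nat).
  assert (Hw4 : (w <= w ^ 4)%nat) by (simpl; nia).
  assert (HM : S M = (96 * w ^ 4)%nat) by (unfold M; lia).
  exists M. split; [lia|].
  assert (EM : INR (S M) = 96 * W ^ 4).
  { rewrite HM, mult_INR, pow_INR. fold W. simpl. ring. }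
  assert (HNW : INR N <= W ^ 4 / 16).
  { assert (H : INR (16 * N) <= W ^ 4) by (unfold W; rewrite <- pow_INR; apply le_INR; lia).
    rewrite mult_INR in H. simpl (INR 16) in H. lra. }
  assert (W3 : 0 < W ^ 3) by (apply pow_lt; lra).
  assert (W4 : 0 < W ^ 4) by (apply pow_lt; lra).
  (* The maximiser of [2 * lam * (W ^ 4 / 16) - lam ^ 2 * (192 * W ^ 7)]; the maximum [W / 49152],
     divided by [80 * W], is the stated constant. *)
  set (lam := / (3072 * W ^ 3)).
  assert (Hlam : 0 < lam) by (apply Rinv_0_lt_compat; lra).
  assert (C : 2 * lam * (lift ell upot (0%Z, O) - W ^ 4 * lift ell fpot (0%Z, O) / INR (S M) - INR N)
     - lam ^ 2 * INR (S M) * INR (length slab)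
     <= 4 * (20 * W) * collision_prob nb Znat_eq_dec (0%Z, O) (0%Z, O) N M).
  { apply collision_prob_criterion with (B := box) (cl := cbox)
      (h := fun z => lift ell (hpot z)).
    - apply comb_nonempty, hairy_ray_nonempty.
    - apply comb_nodup, hairy_ray_simple.
    - apply comb_sym, hairy_ray_simple.
    - apply NoDup_nodup.
    - apply slab_box.
    - intros a. apply deg_comb_le.
    - apply box_cbox.
    - apply box_nb_cbox.
    - apply fpot_nonneg.
    - apply fpot_super.
    - lra.
    - apply upot_le.
    - apply upot_sub.
    - intros z a Hz Ha. now apply hpot_nonneg.
    - apply hpot_super.
    - apply hpot_diag.
    - lra.
    - lra.
    - lia.
    - apply box_cbox, box_iff. change (crd 0) with (O, O). cbn [fst]. unfold e. lia. }
  change (lift ell upot (0%Z, O)) with (upot 0 0 0) in C.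
  change (lift ell fpot (0%Z, O)) with (fpot 0 0 0) in C.
  assert (Hu : upot 0 0 0 = W ^ 4 / 4).
  { unfold upot, hairp. cbn [psum INR]. field. }
  assert (Hf : W ^ 4 * fpot 0 0 0 / INR (S M) <= W ^ 4 / 8).
  { rewrite EM. pose proof fpot_origin.
    apply Rmult_le_reg_r with (96 * W ^ 4); [lra|].
    unfold Rdiv. rewrite Rmult_assoc, Rinv_l by lra. nra. }
  assert (HS : lam ^ 2 * INR (S M) * INR (length slab) <= lam ^ 2 * (96 * W ^ 4) * (2 * W ^ 3)).
  { rewrite EM. apply Rmult_le_compat_l; [|apply slab_length].
    apply Rmult_le_pos; [apply pow2_ge_0|lra]. }
  assert (HL : 2 * lam * (W ^ 4 / 16) <=
    2 * lam * (upot 0 0 0 - W ^ 4 * fpot 0 0 0 / INR (S M) - INR N)).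
  { apply Rmult_le_compat_l; lra. }
  assert (EQ : 2 * lam * (W ^ 4 / 16) - lam ^ 2 * (96 * W ^ 4) * (2 * W ^ 3)
     = 4 * (20 * W) * / 3932160).
  { unfold lam. field. lra. }
  apply Rmult_le_reg_l with (4 * (20 * W)); lra.
Qed.

End Scale.

(** * Choice of the scales and conclusion *)

(* Consecutive scales [2 ^ 3 ^ n] and their cubes leave room for the gaps. *)
Definition hair_length (i : nat) : nat :=
  if existsb (fun n => (3 ^ n =? Nat.log2 i)%nat) (seq 0 (S (Nat.log2 i)))
  then 2 ^ Nat.log2 i else 0.

Lemma hair_length_scale i n : Nat.log2 i = (3 ^ n)%nat -> hair_length i = (2 ^ 3 ^ n)%nat.
Proof.
  intros E. unfold hair_length. rewrite E.
  replace (existsb _ _) with true; [easy|]. symmetry. apply existsb_exists.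
  (* [n < 3 ^ n] keeps the exponent inside the searched range. *)
  exists n. rewrite in_seq, Nat.eqb_eq. pose proof (Nat.pow_gt_lin_r 3 n). lia.
Qed.

Lemma hair_length_gap i n :
  (3 ^ n < Nat.log2 i < 3 ^ S n)%nat -> hair_length i = 0%nat.
Proof.
  intros H. unfold hair_length. destruct existsb eqn:E; [|easy].
  apply existsb_exists in E. destruct E as (m & _ & E). apply Nat.eqb_eq in E.
  rewrite <- E in H. destruct H as [H1 H2].
  apply Nat.pow_lt_mono_r_iff in H1, H2; lia.
Qed.

Theorem theorem1p3 :
  exists (nH : nat -> list nat) (v : nat),
    simple_graph nH /\ bounded_degree nH /\ connected nH /\
    not_finite_collision (comb Zline nH v) Znat_eq_dec.
Proof.
  exists (hairy_ray hair_length), O.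
  split; [apply hairy_ray_simple|]. split; [apply hairy_ray_bounded|].
  split; [apply hairy_ray_connected|].
  exists (0%Z, O), (0%Z, O), (/ 3932160). split; [lra|]. intros N.
  (* The chain [n < 3 ^ n < w] gives [16 * N <= w], and [n >= 1] gives [w >= 4]. *)
  set (n := (16 * N + 1)%nat). set (w := (2 ^ 3 ^ n)%nat).
  assert (Hn : (n < 3 ^ n)%nat) by (apply Nat.pow_gt_lin_r; lia).
  assert (Hw : (3 ^ n < w)%nat) by (apply Nat.pow_gt_lin_r; lia).
  assert (H2 : (2 * w = 2 ^ S (3 ^ n))%nat) by reflexivity.
  assert (H3 : (4 <= w)%nat).
  { change 4%nat with (2 ^ 2)%nat. apply Nat.pow_le_mono_r; lia. }
  apply (hairy_comb_collision hair_length w); try lia.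
  - reflexivity.
  - intros i Hi. unfold hair_length. destruct existsb; [|lia].
    apply Nat.pow_le_mono_r; [lia|]. destruct (Nat.eq_dec i 0) as [->|Ni]; [apply Nat.le_0_l|].
    rewrite H2 in Hi. apply Nat.log2_lt_pow2 in Hi; lia.
  - intros i Hi. apply hair_length_scale. apply Nat.log2_unique; [lia|]. lia.
  - intros i Hi. apply hair_length_gap with n. split.
    + apply Nat.lt_le_trans with (S (3 ^ n)); [lia|]. apply Nat.log2_le_pow2; lia.
    (* The gap ends before [w * w * w], which is the next scale. *)
    + apply Nat.log2_lt_pow2; [lia|]. apply Nat.lt_le_trans with (w * w * w)%nat; [nia|].
      unfold w. rewrite <- !Nat.pow_add_r. apply Nat.pow_le_mono_r; [lia|]. simpl. lia.
Qed.
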